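(* Let $(G,o)$ be a Menger algebra of rank $n$ and let $H\subseteq G$ be a strong subset. If $X$ is an $\mathcal{R}_H$-class with $X\neq W_H$, then $X$ is a strong subset of $(G,o)$ such that $W_H\subseteq W_X$ and $\mathcal{R}_H\subseteq\mathcal{R}_X$. Moreover, the restriction of $\mathcal{R}_H$ to $G\setminus W_X$ coincides with $\mathcal{R}^*_X$, i.e. $\mathcal{R}^*_X=\mathcal{R}_H\cap\big((G\setminus W_X)\times(G\setminus W_X)\big)$.
   Context: Let $n$ be a positive integer. A Menger algebra $(G,o)$ of rank $n$ is a nonempty set $G$ with an $(n+1)$-ary operation $o:(f,g_1,\ldots,g_n)\mapsto f[g_1\ldots g_n]$ satisfying the superassociative law $f[g_1\ldots g_n][h_1\ldots h_n]=f[g_1[h_1\ldots h_n]\ldots g_n[h_1\ldots h_n]]$ for all $f,g_i,h_i\in G$. $T_n(G)$ is the smallest set of polynomials in one variable $x$ such that $x\in T_n(G)$ and, whenever $i\in\{1,\ldots,n\}$, $a,b_1,\ldots,b_{i-1},b_{i+1},\ldots,b_n\in G$ and $t\in T_n(G)$, also $a[b_1\ldots b_{i-1}\,t\,b_{i+1}\ldots b_n]\in T_n(G)$. Each $t\in T_n(G)$ is identified with the map $G\to G$, $x\mapsto t(x)$, it defines. For a subset $K\subseteq G$ and $a\in G$ put $\rho_K\langle a\rangle=\{t\in T_n(G)\mid t(a)\in K\}$, $\mathcal{R}_K=\{(a,b)\in G\times G\mid \rho_K\langle a\rangle=\rho_K\langle b\rangle\}$ (an equivalence relation), $\mathcal{R}^*_K=\{(a,b)\in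 G\times G\mid \rho_K\langle a\rangle=\rho_K\langle b\rangle\neq\varnothing\}$, and $W_K=\{a\in G\mid\rho_K\langle a\rangle=\varnothing\}$. An $\mathcal{R}_K$-class is an equivalence class of $\mathcal{R}_K$. The subset $K$ is called strong if for all $a,b\in G$, $\rho_K\langle a\rangle\cap\rho_K\langle b\rangle\neq\varnothing$ implies $\rho_K\langle a\rangle=\rho_K\langle b\rangle$. *)

(* Defs.v *)
From mathcomp Require Import all_boot.
From mathcomp Require Import boolp classical_sets.

Set Implicit Arguments.
Unset Strict Implicit.
Unset Printing Implicit Defensive.

Local Open Scope classical_set_scope.

(* [mop f g] is f[g_1 ... g_n], with the n inner arguments given as a family. *)
Record mengerAlgebra (n : nat) := MengerAlgebra {
  msort :> Type;
  mop : msort -> ('I_n -> msort) -> msort;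
  mnonempty : inhabited msort;
  msuperassoc : forall (f : msort) (g h : 'I_n -> msort),
    mop (mop f g) h = mop f (fun i => mop (g i) h)
}.

Section Definitions.
Variables (n : nat) (G : mengerAlgebra n).

(* T_n(G), as a set of maps G -> G: polynomials are identified with the maps
   they define. The value [b i] is overridden, hence irrelevant. *)
Inductive Tn : set (G -> G) :=
| Tn_var : Tn (fun x => x)
| Tn_app (i : 'I_n) (a : G) (b : 'I_n -> G) (t : G -> G) :
    Tn t -> Tn (fun x => mop a (fun j => if j == i then t x else b j)).

Definition rho (K : set G) (a : G) : set (G -> G) :=
  [set t | Tn t /\ K (t a)].

Definition RK (K : set G) : set (G * G) :=
  [set p | rho K p.1 = rho K p.2].

Definition RKstar (K : set G) : set (G * G) :=
  [set p | rho K p.1 = rho K p.2 /\ rho K p.2 <> set0].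

Definition WK (K : set G) : set G := [set a | rho K a = set0].

Definition RK_class (K X : set G) : Prop :=
  exists a : G, X = [set b | RK K (a, b)].

Definition strong (K : set G) : Prop :=
  forall a b : G, rho K a `&` rho K b <> set0 -> rho K a = rho K b.

End Definitions.

(* Main.v *)
(** If [t a] and [t b] lie in the class [X], which is not [W_H], then some
    translation [s] sends both into [H]. So [s \o t] belongs to both [rho H a]
    and [rho H b], and strongness of [H] gives [(a, b)] in [R_H]. Conversely,
    [R_H] is stable under translations and [X] is [R_H]-saturated, so
    [R_H]-related elements have the same [rho X]. *)

Require Import Defs.
From mathcomp Require Import all_boot.
From mathcomp Require Import boolp classical_sets.

Local Open Scope classical_set_scope.

Lemma Tn_comp {n : nat} {G : mengerAlgebra n} {s t : G -> G} :
  Tn s -> Tn t -> Tn (fun x => s (t x)).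
Proof.
by move=> Ts Tt; elim: Ts => [//|i a b u _ Tut]; exact: (Tn_app _ _ _ Tut).
Qed.

(** For [s] and [t] in [Tn], [s] belongs to [rho K (t a)] exactly when [s \o t] belongs to
    [rho K a]. *)
Lemma rho_Tn {n : nat} {G : mengerAlgebra n} {K : set G} {t : G -> G}
    {a b : G} :
  Tn t -> rho K a = rho K b -> rho K (t a) = rho K (t b).
Proof.
move=> Tt eq_ab; apply/seteqP; split=> s [Ts Ks]; split=> //.
- have : rho K a (fun x => s (t x)) by split=> //; exact: Tn_comp.
  by rewrite eq_ab => -[].
- have : rho K b (fun x => s (t x)) by split=> //; exact: Tn_comp.
  by rewrite -eq_ab => -[].
Qed.

Lemma RK_class_RK {n : nat} {G : mengerAlgebra n} {H X : set G} :
  RK_class H X -> RK H `<=` RK X.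
Proof.
move=> [c ->] [a b]; rewrite /RK /= => eq_ab.
by apply/seteqP; split=> t [Tt /= ct]; split=> //=;
  rewrite ct; apply: rho_Tn.
Qed.

(** When nonempty, [WK H] is itself a class of [RK H], so a class that meets it equals it. *)
Lemma RK_class_rho_neq0 {n : nat} {G : mengerAlgebra n} {H X : set G} {x : G} :
  RK_class H X -> X <> WK H -> X x -> rho H x !=set0.
Proof.
move=> [c ->] XneqW; rewrite /RK /= => <-; apply/set0P/eqP => c0.
by apply: XneqW; rewrite /RK /WK /= c0; apply/seteqP; split=> b /= ->.
Qed.

(** Used twice: with [RK H] inside [RK X] it makes [X] strong, and it places [RKstar X] inside
    [RK H]. *)
Lemma rhoI_RK {n : nat} {G : mengerAlgebra n} {H X : set G} {a b : G} :
  strong H -> RK_class H X -> X <> WK H ->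
  rho X a `&` rho X b !=set0 -> rho H a = rho H b.
Proof.
move=> strongH classX XneqW [t [[Tt Xta] [_ Xtb]]]; apply: strongH.
have [s sta] := RK_class_rho_neq0 classX XneqW Xta.
have eq_t : rho H (t a) = rho H (t b).
  by move: classX Xta Xtb => [c ->]; rewrite /RK /= => <- <-.
have := sta; rewrite eq_t => -[_ Hstb].
case: sta => Ts Hsta.
apply/eqP/set0P; exists (fun x => s (t x)).
by split; split=> //; exact: Tn_comp.
Qed.

Theorem theorem2p11 (n : nat) (n_gt0 : (0 < n)%N) (G : mengerAlgebra n)
    (H X : set G) (strongH : strong H) (classX : RK_class H X)
    (XneqW : X <> WK H) :
  [/\ strong X,
      WK H `<=` WK X,
      RK H `<=` RK X
    & RKstar X = RK H `&` ((~` WK X) `*` (~` WK X))].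
Proof.
have subR := RK_class_RK classX.
split=> //.
- move=> a b /eqP/set0P ab; apply: (subR (a, b)).
  exact: (rhoI_RK strongH classX XneqW ab).
(* If [t] sent [a] into [X], then [s \o t] would lie in the empty set [rho H a]. *)
- move=> a; rewrite /WK /= => a0; rewrite -subset0 => t [Tt Xta].
  have [s [Ts Hsta]] := RK_class_rho_neq0 classX XneqW Xta.
  have : rho H a (fun x => s (t x)) by split=> //; exact: Tn_comp.
  by rewrite a0.
- apply/seteqP; split=> -[a b]; rewrite /RKstar /WK /=.
  + move=> [eq_ab b0]; split; last by rewrite /= eq_ab.
    (* The two sets [rho X a] and [rho X b] coincide, so their intersection is the nonempty
       [rho X b]. *)
    apply: (rhoI_RK strongH classX XneqW).
    by rewrite eq_ab setIid; apply/set0P/eqP.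
  + by move=> [Hab [_ b0]]; split=> //; exact: (subR (a, b)).
Qed.
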